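(* Let $f(z)=h(z)\overline{g(z)}$ be a nonvanishing logharmonic mapping in the unit disk $\mathbb{D}$ with dilatation $\omega$. Then $f$ is a logharmonic Bloch function if and only if $\log h$ is an analytic Bloch function.
   Context: $\mathbb{D}=\{z\in\mathbb{C}:|z|<1\}$. A logharmonic mapping $f$ in $\mathbb{D}$ is a solution of $\overline{f_{\overline z}}/\overline{f}=\omega f_z/f$, where the (second) dilatation $\omega:\mathbb{D}\to\mathbb{D}$ is analytic. A nonvanishing logharmonic mapping is expressed as $f=h\overline{g}$ with $h,g$ nonvanishing analytic functions in $\mathbb{D}$; the equation then reads $g'/g=\omega\, h'/h$ in $\mathbb{D}$. Here $\log h$ denotes an analytic branch in $\mathbb{D}$ of the logarithm of $h$. An analytic function $u$ in $\mathbb{D}$ is called a Bloch function if $\sup_{z\in\mathbb{D}}(1-|z|^2)|u'(z)|<\infty$. A nonvanishing logharmonic mapping $f=h\overline{g}$ in $\mathbb{D}$ is called a logharmonic Bloch function if $$\beta_f=\sup_{z\in\mathbb{D}}(1-|z|^2)\left\{\left|\frac{h'(z)}{h(z)}\right|+\left|\frac{g'(z)}{g(z)}\right|\right\}<\infty.$$ *)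

(* Defs.v *)
From Stdlib Require Export Reals.
From Coquelicot Require Export Coquelicot.

Open Scope R_scope.

(* Functions on the disk are total functions C -> C of which only the values
   on the disk matter: the disk is open, so all derivatives below are local. *)
Definition unit_disk (z : C) : Prop := Cmod z < 1.

(* The derivative is the complex one (scalar field C_AbsRing). *)
Definition analytic_in_disk (u : C -> C) : Prop :=
  forall z : C, unit_disk z ->
    @ex_derive C_AbsRing C_NormedModule u z.

Definition sup_disk (phi : C -> R) : Rbar :=
  Lub_Rbar (fun r : R => exists z : C, unit_disk z /\ r = phi z).

(* Partial derivatives of f : R^2 -> R^2, meaningful where f is
   real-differentiable. *)
Definition partial_x (f : C -> C) (z : C) : C :=
  (Derive (fun t : R => Re (f (t, Im z))) (Re z),
   Derive (fun t : R => Im (f (t, Im z))) (Re z)).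

Definition partial_y (f : C -> C) (z : C) : C :=
  (Derive (fun t : R => Re (f (Re z, t))) (Im z),
   Derive (fun t : R => Im (f (Re z, t))) (Im z)).

Definition d_z (f : C -> C) (z : C) : C :=
  ((partial_x f z - Ci * partial_y f z) / 2)%C.

Definition d_zbar (f : C -> C) (z : C) : C :=
  ((partial_x f z + Ci * partial_y f z) / 2)%C.

Definition real_differentiable (f : C -> C) (z : C) : Prop :=
  @ex_filterdiff R_AbsRing C_R_NormedModule C_R_NormedModule f (locally z).

Definition dilatation_in_disk (omega : C -> C) : Prop :=
  analytic_in_disk omega /\
  (forall z : C, unit_disk z -> unit_disk (omega z)).

Definition nonvanishing_logharmonic (f omega : C -> C) : Prop :=
  dilatation_in_disk omega /\
  forall z : C, unit_disk z ->
    f z <> 0%C /\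
    real_differentiable f z /\
    (Cconj (d_zbar f z) / Cconj (f z) = omega z * (d_z f z / f z))%C.

Definition logharmonic_factors (f h g : C -> C) : Prop :=
  analytic_in_disk h /\ analytic_in_disk g /\
  forall z : C, unit_disk z ->
    h z <> 0%C /\ g z <> 0%C /\ f z = (h z * Cconj (g z))%C.

(* The exponential e^(x+iy) = e^x (cos y + i sin y), absent from Coquelicot. *)
Definition Cexp (z : C) : C :=
  (exp (Re z) * cos (Im z), exp (Re z) * sin (Im z)).

Definition log_branch (h L : C -> C) : Prop :=
  analytic_in_disk L /\
  forall z : C, unit_disk z -> Cexp (L z) = h z.

Definition bloch (u : C -> C) : Prop :=
  analytic_in_disk u /\
  Rbar_lt (sup_disk (fun z => (1 - Cmod z ^ 2) * Cmod (C_derive u z)))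
          p_infty.

(* The factors of f are unique up to h -> c h, g -> g / conj c with c a nonzero
   constant, so beta depends only on f = h * conj g. *)
Definition beta (h g : C -> C) : Rbar :=
  sup_disk (fun z =>
    (1 - Cmod z ^ 2) *
    (Cmod (C_derive h z / h z) + Cmod (C_derive g z / g z))).

Definition logharmonic_bloch (h g : C -> C) : Prop :=
  Rbar_lt (beta h g) p_infty.

(* Main.v *)
Require Import Defs.
From Stdlib Require Import Lra.

(** Differentiating [exp (log h) = h] gives [(log h)' = h'/h], and the Wirtinger
    derivatives of [f = h * conj g] are [f_z = h' * conj g] and
    [f_zbar = h * conj g'], so that the logharmonic equation becomes
    [g'/g = omega * (h'/h)] ([logharmonic_log_derivatives]).  Since
    [|omega| < 1], the two quantities whose suprema are compared satisfy
    [|h'/h| <= |h'/h| + |g'/g| <= 2 |h'/h|] pointwise, with [h'/h = (log h)'];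
    multiplying by [1 - |z|^2 >= 0] shows that both suprema are finite or both
    are infinite.

    All the complex differentiation is reduced to real calculus along the two
    coordinate axes: a complex derivative [l] of [u] gives the real partial
    derivatives [u_x = l] and [u_y = i l] ([is_derive_along]).  The Wirtinger
    derivatives are defined by these partial derivatives, and the identity
    [(log h)' = h'/h] can be read off the [x]-direction alone. *)

(** * Suprema and local behaviour on the disk *)

Lemma sup_disk_lt_p_infty (phi : C -> R) :
  Rbar_lt (sup_disk phi) p_infty <->
  exists M : R, forall z : C, unit_disk z -> phi z <= M.
Proof.
  unfold sup_disk; set (E := fun r : R => _).
  destruct (Lub_Rbar_correct E) as [Hub Hleast].
  split.
  - intros Hlt.
    destruct (Lub_Rbar E) as [m | | ]; simpl in Hlt; try contradiction.
    + exists m; intros z Hz. apply (Hub (phi z)). now exists z.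
    + exists 0; intros z Hz.
      destruct (Hub (phi z)). now exists z.
  - intros [M HM].
    apply Rbar_le_lt_trans with (Finite M); [| exact I].
    apply Hleast. intros r [z [Hz ->]]. exact (HM z Hz).
Qed.

Lemma one_minus_Cmod2_pos (z : C) : unit_disk z -> 0 < 1 - Cmod z ^ 2.
Proof. unfold unit_disk; intros Hz. pose proof (Cmod_ge_0 z). nra. Qed.

(** Identities known only on the disk, such as [f = h * conj g], may thus be
    differentiated along lines through its points. *)
Lemma unit_disk_locally_along (z a : C) (gam : R -> C) (t0 : R) :
  Cmod a = 1 -> gam t0 = z ->
  (forall t, gam t = (gam t0 + (t - t0)%R * a)%C) ->
  unit_disk z -> locally t0 (fun t => unit_disk (gam t)).
Proof.
  unfold unit_disk; intros Ha Hz Hgam Hd.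
  assert (Hpos : 0 < 1 - Cmod z) by lra.
  exists (mkposreal _ Hpos); intros t Ht.
  change (Rabs (t - t0) < 1 - Cmod z) in Ht.
  rewrite Hgam, Hz.
  apply Rle_lt_trans with (1 := Cmod_triangle _ _).
  rewrite Cmod_mult, Ha, Cmod_R. lra.
Qed.

(** * Partial derivatives of holomorphic functions *)

(** The error term of a complex derivative is small in every direction, in
    particular on a line, where increments of [z] are real multiples of [a].
    Used with [phi] being [Re] or [Im], and [a] being [1] or [i]; one statement
    covers the four real partial derivatives below. *)
Lemma is_derive_along (phi : C -> R) (u : C -> C) (z l a : C)
    (gam : R -> C) (t0 : R) :
  (forall v w, phi (v - w)%C = phi v - phi w) ->
  (forall (s : R) w, phi (s * w)%C = s * phi w) ->
  (forall w, Rabs (phi w) <= Cmod w) ->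
  Cmod a = 1 -> gam t0 = z ->
  (forall t, gam t = (gam t0 + (t - t0)%R * a)%C) ->
  @is_derive C_AbsRing C_NormedModule u z l ->
  is_derive (fun t => phi (u (gam t))) t0 (phi (a * l)%C).
Proof.
  intros Hsub Hscal Hle Ha Hz Hgam [_ Hu].
  specialize (Hu z (fun P HP => HP)).
  split; [apply is_linear_scal_l |].
  intros x Hx eps.
  rewrite <- (is_filter_lim_locally_unique t0 x Hx); clear x Hx.
  destruct (Hu eps) as [d Hd].
  exists d; intros t Ht.
  change (Rabs (t - t0) < d) in Ht.
  change (Rabs (phi (u (gam t)) - phi (u (gam t0)) - (t - t0) * phi (a * l)%C)
          <= eps * Rabs (t - t0)).
  assert (Hdist : (gam t - z)%C = ((t - t0)%R * a)%C).
  { rewrite Hgam, Hz. ring. }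
  assert (Hmod : Cmod (gam t - z) = Rabs (t - t0)).
  { now rewrite Hdist, Cmod_mult, Ha, Cmod_R, Rmult_1_r. }
  assert (Hball : Cmod (gam t - z) < d) by (now rewrite Hmod).
  specialize (Hd (gam t) Hball).
  change (Cmod (u (gam t) - u z - (gam t - z) * l)%C
          <= eps * Cmod (gam t - z)%C) in Hd.
  rewrite Hmod, Hdist in Hd.
  rewrite <- Hscal, Hz, <- !Hsub.
  replace ((t - t0)%R * (a * l))%C with ((t - t0)%R * a * l)%C by ring.
  now apply Rle_trans with (1 := Hle _).
Qed.

Lemma Re_minus (v w : C) : Re (v - w)%C = Re v - Re w.
Proof. reflexivity. Qed.

Lemma Im_minus (v w : C) : Im (v - w)%C = Im v - Im w.
Proof. reflexivity. Qed.

Lemma Re_scal (s : R) (w : C) : Re (s * w)%C = s * Re w.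
Proof. unfold Re; simpl; ring. Qed.

Lemma Im_scal (s : R) (w : C) : Im (s * w)%C = s * Im w.
Proof. unfold Im; simpl; ring. Qed.

Lemma Im_le_Cmod (w : C) : Rabs (Im w) <= Cmod w.
Proof.
  apply Rle_trans with (2 := Rmax_Cmod w). apply Rmax_r.
Qed.

Lemma Cmod_Ci : Cmod Ci = 1.
Proof.
  transitivity (sqrt 1); [| exact sqrt_1].
  unfold Cmod, Ci; simpl. f_equal; ring.
Qed.

Lemma horizontal_line (x y t : R) :
  ((t, y) : C) = ((x, y) + (t - x)%R * 1)%C.
Proof. apply injective_projections; simpl; ring. Qed.

Lemma vertical_line (x y t : R) :
  ((x, t) : C) = ((x, y) + (t - y)%R * Ci)%C.
Proof. apply injective_projections; simpl; ring. Qed.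

Lemma is_derive_Re_x (u : C -> C) (x y : R) (l : C) :
  @is_derive C_AbsRing C_NormedModule u (x, y) l ->
  is_derive (fun t => Re (u (t, y))) x (Re l).
Proof.
  intros Hu.
  rewrite <- (Cmult_1_l l).
  apply (is_derive_along Re u (x, y) l 1 (fun t => (t, y)) x); auto using
    Re_minus, Re_scal, re_le_Cmod, Cmod_1, horizontal_line.
Qed.

Lemma is_derive_Im_x (u : C -> C) (x y : R) (l : C) :
  @is_derive C_AbsRing C_NormedModule u (x, y) l ->
  is_derive (fun t => Im (u (t, y))) x (Im l).
Proof.
  intros Hu.
  rewrite <- (Cmult_1_l l).
  apply (is_derive_along Im u (x, y) l 1 (fun t => (t, y)) x); auto using
    Im_minus, Im_scal, Im_le_Cmod, Cmod_1, horizontal_line.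
Qed.

Lemma is_derive_Re_y (u : C -> C) (x y : R) (l : C) :
  @is_derive C_AbsRing C_NormedModule u (x, y) l ->
  is_derive (fun t => Re (u (x, t))) y (- Im l).
Proof.
  intros Hu.
  replace (- Im l) with (Re (Ci * l)%C) by (unfold Re, Im; simpl; ring).
  apply (is_derive_along Re u (x, y) l Ci (fun t => (x, t)) y); auto using
    Re_minus, Re_scal, re_le_Cmod, Cmod_Ci, vertical_line.
Qed.

Lemma is_derive_Im_y (u : C -> C) (x y : R) (l : C) :
  @is_derive C_AbsRing C_NormedModule u (x, y) l ->
  is_derive (fun t => Im (u (x, t))) y (Re l).
Proof.
  intros Hu.
  replace (Re l) with (Im (Ci * l)%C) by (unfold Re, Im; simpl; ring).
  apply (is_derive_along Im u (x, y) l Ci (fun t => (x, t)) y); auto using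
    Im_minus, Im_scal, Im_le_Cmod, Cmod_Ci, vertical_line.
Qed.

Lemma unit_disk_locally_x (x y : R) :
  unit_disk (x, y) -> locally x (fun t => unit_disk (t, y)).
Proof.
  apply (unit_disk_locally_along (x, y) 1 (fun t => (t, y)) x);
    auto using Cmod_1, horizontal_line.
Qed.

Lemma unit_disk_locally_y (x y : R) :
  unit_disk (x, y) -> locally y (fun t => unit_disk (x, t)).
Proof.
  apply (unit_disk_locally_along (x, y) Ci (fun t => (x, t)) y);
    auto using Cmod_Ci, vertical_line.
Qed.

Lemma analytic_is_derive (u : C -> C) (z : C) :
  analytic_in_disk u -> unit_disk z ->
  @is_derive C_AbsRing C_NormedModule u z (C_derive u z).
Proof. intros Hu Hz. exact (C_derive_correct u z z (Hu z Hz)). Qed.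

(** * Logarithmic derivatives *)

Lemma is_derive_Rmult (p q : R -> R) (t dp dq : R) :
  is_derive p t dp -> is_derive q t dq ->
  is_derive (fun s => p s * q s) t (dp * q t + p t * dq).
Proof.
  intros Hp Hq. exact (is_derive_mult p q t dp dq Hp Hq Rmult_comm).
Qed.

(** The complex derivative of [h = exp L] is determined by its
    [x]-derivative, which the real chain rule computes. *)
Lemma log_branch_derive (h L : C -> C) (z : C) :
  analytic_in_disk h -> log_branch h L -> unit_disk z ->
  C_derive h z = (h z * C_derive L z)%C.
Proof.
  intros Hh [HL Hexp] Hz.
  pose proof (analytic_is_derive h z Hh Hz) as Dh.
  pose proof (analytic_is_derive L z HL Hz) as DL.
  rewrite <- (Hexp z Hz).
  destruct z as [x y].
  set (h' := C_derive h (x, y)) in *; set (L' := C_derive L (x, y)) in *.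
  clearbody h' L'.
  pose proof (is_derive_Re_x L x y L' DL) as DRe.
  pose proof (is_derive_Im_x L x y L' DL) as DIm.
  pose proof (is_derive_comp exp _ x _ _ (is_derive_exp _) DRe) as De.
  pose proof (is_derive_comp cos _ x _ _ (is_derive_cos _) DIm) as Dc.
  pose proof (is_derive_comp sin _ x _ _ (is_derive_sin _) DIm) as Ds.
  assert (Hloc : locally x (fun t => Cexp (L (t, y)) = h (t, y))).
  { apply (filter_imp (fun t => unit_disk (t, y))).
    - intros t; apply Hexp.
    - now apply unit_disk_locally_x. }
  assert (Hre : is_derive (fun t => Re (h (t, y))) x
                  (Re (Cexp (L (x, y)) * L')%C)).
  { apply is_derive_ext_loc
      with (fun t => exp (Re (L (t, y))) * cos (Im (L (t, y)))).
    - revert Hloc; apply filter_imp; intros t Ht; exact (f_equal Re Ht).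
    - eapply eq_ind; [exact (is_derive_Rmult _ _ x _ _ De Dc) |].
      unfold scal, Cexp, Re, Im; simpl; unfold mult; simpl; ring. }
  assert (Him : is_derive (fun t => Im (h (t, y))) x
                  (Im (Cexp (L (x, y)) * L')%C)).
  { apply is_derive_ext_loc
      with (fun t => exp (Re (L (t, y))) * sin (Im (L (t, y)))).
    - revert Hloc; apply filter_imp; intros t Ht; exact (f_equal Im Ht).
    - eapply eq_ind; [exact (is_derive_Rmult _ _ x _ _ De Ds) |].
      unfold scal, Cexp, Re, Im; simpl; unfold mult; simpl; ring. }
  apply injective_projections.
  - change (Re h' = Re (Cexp (L (x, y)) * L')%C).
    rewrite <- (is_derive_unique _ _ _ Hre).
    symmetry; apply is_derive_unique, (is_derive_Re_x h x y h' Dh).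
  - change (Im h' = Im (Cexp (L (x, y)) * L')%C).
    rewrite <- (is_derive_unique _ _ _ Him).
    symmetry; apply is_derive_unique, (is_derive_Im_x h x y h' Dh).
Qed.

Lemma partial_x_factors (f h g : C -> C) (z : C) :
  logharmonic_factors f h g -> unit_disk z ->
  partial_x f z =
  (C_derive h z * Cconj (g z) + h z * Cconj (C_derive g z))%C.
Proof.
  intros Hfac Hz; destruct Hfac as (Hh & Hg & Hf).
  pose proof (analytic_is_derive h z Hh Hz) as Dh.
  pose proof (analytic_is_derive g z Hg Hz) as Dg.
  destruct z as [x y].
  set (h' := C_derive h (x, y)) in *; set (g' := C_derive g (x, y)) in *.
  clearbody h' g'.
  pose proof (is_derive_Re_x h x y h' Dh) as Dhr.
  pose proof (is_derive_Im_x h x y h' Dh) as Dhi.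
  pose proof (is_derive_Re_x g x y g' Dg) as Dgr.
  pose proof (is_derive_Im_x g x y g' Dg) as Dgi.
  assert (Hloc : locally x (fun t => (h (t, y) * Cconj (g (t, y)))%C = f (t, y))).
  { apply (filter_imp (fun t => unit_disk (t, y))).
    - intros t Ht; symmetry; apply (Hf _ Ht).
    - now apply unit_disk_locally_x. }
  apply injective_projections; unfold partial_x; apply is_derive_unique.
  - apply is_derive_ext_loc
      with (fun t => Re (h (t, y)) * Re (g (t, y)) + Im (h (t, y)) * Im (g (t, y))).
    + revert Hloc; apply filter_imp; intros t Ht.
      refine (eq_trans _ (f_equal Re Ht)); unfold Re, Im; simpl; ring.
    + eapply eq_ind.
      * exact (is_derive_plus _ _ x _ _ (is_derive_Rmult _ _ x _ _ Dhr Dgr)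
                 (is_derive_Rmult _ _ x _ _ Dhi Dgi)).
      * unfold plus, Re, Im; simpl; ring.
  - apply is_derive_ext_loc
      with (fun t => Im (h (t, y)) * Re (g (t, y)) - Re (h (t, y)) * Im (g (t, y))).
    + revert Hloc; apply filter_imp; intros t Ht.
      refine (eq_trans _ (f_equal Im Ht)); unfold Re, Im; simpl; ring.
    + eapply eq_ind.
      * exact (is_derive_minus _ _ x _ _ (is_derive_Rmult _ _ x _ _ Dhi Dgr)
                 (is_derive_Rmult _ _ x _ _ Dhr Dgi)).
      * unfold minus, plus, opp, Re, Im; simpl; ring.
Qed.

Lemma partial_y_factors (f h g : C -> C) (z : C) :
  logharmonic_factors f h g -> unit_disk z ->
  partial_y f z =
  (Ci * (C_derive h z * Cconj (g z) - h z * Cconj (C_derive g z)))%C.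
Proof.
  intros Hfac Hz; destruct Hfac as (Hh & Hg & Hf).
  pose proof (analytic_is_derive h z Hh Hz) as Dh.
  pose proof (analytic_is_derive g z Hg Hz) as Dg.
  destruct z as [x y].
  set (h' := C_derive h (x, y)) in *; set (g' := C_derive g (x, y)) in *.
  clearbody h' g'.
  pose proof (is_derive_Re_y h x y h' Dh) as Dhr.
  pose proof (is_derive_Im_y h x y h' Dh) as Dhi.
  pose proof (is_derive_Re_y g x y g' Dg) as Dgr.
  pose proof (is_derive_Im_y g x y g' Dg) as Dgi.
  assert (Hloc : locally y (fun t => (h (x, t) * Cconj (g (x, t)))%C = f (x, t))).
  { apply (filter_imp (fun t => unit_disk (x, t))).
    - intros t Ht; symmetry; apply (Hf _ Ht).
    - now apply unit_disk_locally_y. }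
  apply injective_projections; unfold partial_y; apply is_derive_unique.
  - apply is_derive_ext_loc
      with (fun t => Re (h (x, t)) * Re (g (x, t)) + Im (h (x, t)) * Im (g (x, t))).
    + revert Hloc; apply filter_imp; intros t Ht.
      refine (eq_trans _ (f_equal Re Ht)); unfold Re, Im; simpl; ring.
    + eapply eq_ind.
      * exact (is_derive_plus _ _ y _ _ (is_derive_Rmult _ _ y _ _ Dhr Dgr)
                 (is_derive_Rmult _ _ y _ _ Dhi Dgi)).
      * unfold plus, Re, Im; simpl; ring.
  - apply is_derive_ext_loc
      with (fun t => Im (h (x, t)) * Re (g (x, t)) - Re (h (x, t)) * Im (g (x, t))).
    + revert Hloc; apply filter_imp; intros t Ht.
      refine (eq_trans _ (f_equal Im Ht)); unfold Re, Im; simpl; ring.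
    + eapply eq_ind.
      * exact (is_derive_minus _ _ y _ _ (is_derive_Rmult _ _ y _ _ Dhi Dgr)
                 (is_derive_Rmult _ _ y _ _ Dhr Dgi)).
      * unfold minus, plus, opp, Re, Im; simpl; ring.
Qed.

Lemma d_z_factors (f h g : C -> C) (z : C) :
  logharmonic_factors f h g -> unit_disk z ->
  d_z f z = (C_derive h z * Cconj (g z))%C.
Proof.
  intros Hfac Hz.
  unfold d_z; rewrite (partial_x_factors f h g), (partial_y_factors f h g) by assumption.
  apply injective_projections; simpl; field.
Qed.

Lemma d_zbar_factors (f h g : C -> C) (z : C) :
  logharmonic_factors f h g -> unit_disk z ->
  d_zbar f z = (h z * Cconj (C_derive g z))%C.
Proof.
  intros Hfac Hz.
  unfold d_zbar; rewrite (partial_x_factors f h g), (partial_y_factors f h g) by assumption.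
  apply injective_projections; simpl; field.
Qed.

Lemma Cconj_neq_0 (w : C) : w <> 0%C -> Cconj w <> 0%C.
Proof.
  intros Hw H. apply Hw. rewrite <- (Cconj_conj w), H.
  apply injective_projections; simpl; ring.
Qed.

(** In [conj f_zbar / conj f] the factor [conj h] cancels, and in [f_z / f] the
    factor [conj g] does. *)
Lemma logharmonic_log_derivatives (f h g omega : C -> C) (z : C) :
  nonvanishing_logharmonic f omega -> logharmonic_factors f h g ->
  unit_disk z ->
  (C_derive g z / g z)%C = (omega z * (C_derive h z / h z))%C.
Proof.
  intros [_ Hf] Hfac Hz.
  destruct (Hf z Hz) as (_ & _ & Heq).
  rewrite (d_z_factors f h g z Hfac Hz), (d_zbar_factors f h g z Hfac Hz) in Heq.
  destruct Hfac as (_ & _ & Hhg).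
  destruct (Hhg z Hz) as (Hh0 & Hg0 & Hfz).
  rewrite Hfz, !Cmult_conj, !Cconj_conj in Heq.
  pose proof (Cconj_neq_0 _ Hh0) as Hh0'.
  pose proof (Cconj_neq_0 _ Hg0) as Hg0'.
  transitivity (Cconj (h z) * C_derive g z / (Cconj (h z) * g z))%C.
  - field; auto.
  - rewrite Heq. field; auto.
Qed.

Theorem theorem3p3 (f h g omega logh : C -> C)
  (hf : nonvanishing_logharmonic f omega)
  (hfac : logharmonic_factors f h g)
  (hlog : log_branch h logh) :
  logharmonic_bloch h g <-> bloch logh.
Proof.
  assert (Hlog : forall z, unit_disk z ->
            (C_derive h z / h z)%C = C_derive logh z).
  { intros z Hz.
    destruct hfac as (Hh & _ & Hhg).
    rewrite (log_branch_derive h logh z Hh hlog Hz).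
    field. apply (Hhg z Hz). }
  assert (Hg : forall z, unit_disk z ->
            Cmod (C_derive g z / g z) <= Cmod (C_derive logh z)).
  { intros z Hz.
    rewrite (logharmonic_log_derivatives f h g omega z hf hfac Hz).
    rewrite Cmod_mult, (Hlog z Hz).
    destruct hf as [[_ Hom] _]. specialize (Hom z Hz). unfold unit_disk in Hom.
    pose proof (Cmod_ge_0 (C_derive logh z)). nra. }
  unfold logharmonic_bloch, beta, bloch.
  rewrite !sup_disk_lt_p_infty.
  split.
  - intros [M HM]. split; [apply hlog |].
    exists M; intros z Hz.
    apply Rle_trans with (2 := HM z Hz).
    apply Rmult_le_compat_l; [now apply Rlt_le, one_minus_Cmod2_pos |].
    rewrite (Hlog z Hz).
    pose proof (Cmod_ge_0 (C_derive g z / g z)). lra.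
  - intros [_ [M HM]].
    exists (2 * M); intros z Hz.
    specialize (HM z Hz); specialize (Hg z Hz).
    pose proof (one_minus_Cmod2_pos z Hz).
    rewrite (Hlog z Hz). nra.
Qed.
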